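(* For any discrete group $G$, the pair $(\beta G/\Xi,\mathfrak h_\Xi)$ is the Bohr compactification of $G$, where $\Xi$ is the least closed congruence on $\beta G$ such that $\{(u,1_G):u\text{ is a Schur ultrafilter on }G\}\subset\Xi$, and $\mathfrak h_\Xi:G\to\beta G/\Xi$ is given by $\mathfrak h_\Xi(x)=[x]_\Xi$.
   Context: All topological spaces are assumed Hausdorff. A topological group is a group with a topology in which multiplication and inversion are continuous. For a discrete semigroup $S$, $\beta S$ is the Stone-Čech compactification of $S$: the set of all ultrafilters on $S$ with the topology given by the base of sets $\{u\in\beta S:A\in u\}$, $A\subseteq S$; each $x\in S$ is identified with the principal ultrafilter $\{A\subseteq S:x\in A\}$. The operation of $S$ extends to $\beta S$ by: $A\in uv$ iff $\{s\in S:\{t\in S: st\in A\}\in v\}\in u$; with it $\beta S$ is a compact semigroup with all right shifts $x\mapsto xu$ continuous. A congruence on a semigroup $S$ is an equivalence relation $\rho$ such that $(a_1,b_1),(a_2,b_2)\in\rho$ imply $(a_1a_2,b_1b_2)\in\rho$; $[x]_\rho$ is the $\rho$-class of $x$ and $S/\rho$ is the quotient semigroup, with operation $[x]_\rho[y]_\rho=[xy]_\rho$ and the quotient topology. A congruence on $\beta G$ is closed if it is a closed subset of $\beta G\times\beta G$; intersections of closed congruences are closed congruences, so the least closed congruence containing a given relation exists. An ultrafilter $u$ on a group $G$ is Schur if for each $U\in u$ there exist $x,y\in U$ such that $xy\in U$. The Bohr compactification of a topological group $G$ is a pair $(\mathfrak bG,b)$ consisting of a compact topological group $\mathfrak bG$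 and a continuous homomorphism $b:G\to\mathfrak bG$ such that $b(G)$ is dense in $\mathfrak bG$ and for each compact topological group $H$ and continuous homomorphism $f:G\to H$ there exists a continuous homomorphism $g:\mathfrak bG\to H$ with $f=g\circ b$. (This determines $\mathfrak bG$ up to topological isomorphism.) *)

(* Defs.v *)
From HB Require Import structures.
From mathcomp Require Import all_boot generic_quotient.
From mathcomp Require Import all_classical topology.

Set Implicit Arguments.
Unset Strict Implicit.
Unset Printing Implicit Defensive.

Local Open Scope classical_set_scope.
Local Open Scope quotient_scope.
Local Open Scope group_scope.

(* No compatibility is required between the product and the topology: being a
   topological group is a property of such a structure, so that it can be
   asserted of a quotient that is only a semigroup by construction. *)
#[short(type="preTopologicalSemigroupType")]
HB.structure Definition PreTopologicalSemigroup :=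
  {S of Semigroup S & Topological S}.

Definition topological_group (K : preTopologicalSemigroupType) : Prop :=
  hausdorff_space K /\
  exists (e : K) (inv : K -> K),
    [/\ left_id e *%g /\ right_id e *%g,
        left_inverse e inv *%g /\ right_inverse e inv *%g,
        continuous (fun xy : K * K => xy.1 * xy.2) &
        continuous inv].

Definition compact_topological_group (K : preTopologicalSemigroupType) : Prop :=
  topological_group K /\ compact [set: K].

Definition continuous_hom (G H : preTopologicalSemigroupType) (f : G -> H) :=
  continuous f /\ {morph f : x y / x * y}.

Definition bohr_compactification (G K : preTopologicalSemigroupType)
    (b : G -> K) : Prop :=
  [/\ topological_group G,
      compact_topological_group K,
      continuous_hom b,
      dense (range b) &
      forall (H : preTopologicalSemigroupType) (f : G -> H),
        compact_topological_group H -> continuous_hom f ->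
        exists2 g : K -> H, continuous_hom g & f = g \o b].

HB.instance Definition _ (G : groupType) :=
  Group.copy (discrete_topology G) G.

Record stone_cech (S : Type) := StoneCech {
  ultra_sets : set_system S;
  ultra_setsP : UltraFilter ultra_sets }.

Section StoneCechTopology.
Variable S : Type.
Implicit Types u v : stone_cech S.

Lemma stone_cech_eq u v : ultra_sets u = ultra_sets v -> u = v.
Proof.
case: u v => [u Pu] [v Pv] /= uv; subst v.
by congr StoneCech; exact: Prop_irrelevance.
Qed.

HB.instance Definition _ := gen_eqMixin (stone_cech S).
HB.instance Definition _ := gen_choiceMixin (stone_cech S).

Definition stone_base (A : set S) : set (stone_cech S) :=
  [set u | ultra_sets u A].

Let stone_base_cover : \bigcup_(A in [set: set S]) stone_base A = setT.
Proof.
rewrite -subTset => u _; exists setT => //; have := ultra_setsP u.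
by move=> uU; exact: (@filterT _ (ultra_sets u)).
Qed.

Let stone_base_join (A B : set S) u : setT A -> setT B ->
  stone_base A u -> stone_base B u ->
  exists C, [/\ setT C, stone_base C u &
    stone_base C `<=` stone_base A `&` stone_base B].
Proof.
move=> _ _ uA uB; have uU := ultra_setsP u.
exists (A `&` B); split => //; first exact: (@filterI _ (ultra_sets u)).
move=> v vAB; have vU := ultra_setsP v.
by split; apply: (@filterS _ (ultra_sets v) _ _ _ _ vAB) => x [].
Qed.

HB.instance Definition _ := isBaseTopological.Build (stone_cech S)
  stone_base_cover stone_base_join.

Definition principal_ultra (x : S) : stone_cech S :=
  StoneCech (principal_filter_ultra x).

End StoneCechTopology.

Section StoneCechSemigroup.
Variable S : semigroupType.
Implicit Types u v w : stone_cech S.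

Definition stone_mul_sets u v : set_system S :=
  [set A | ultra_sets u [set s | ultra_sets v [set t | A (s * t)]]].

Lemma stone_mul_ultra u v : UltraFilter (stone_mul_sets u v).
Proof.
have uU := ultra_setsP u; have vU := ultra_setsP v.
have uF : Filter (ultra_sets u) by exact: filter_filter.
have vF : Filter (ultra_sets v) by exact: filter_filter.
have uvP : ProperFilter (stone_mul_sets u v).
  split.
    move=> uv0; apply: (@filter_not_empty _ (ultra_sets u)).
    apply: (@filterS _ _ uF) uv0 => s; exact: filter_not_empty.
  split.
  - have -> : stone_mul_sets u v setT = ultra_sets u setT.
      congr ultra_sets; apply/seteqP; split => // s _; exact: (@filterT _ _ vF).
    exact: filterT.
  - move=> A B uA uB.
    by apply: (@filterS _ _ uF) (@filterI _ _ uF _ _ uA uB) => s [? ?]; exact: (@filterI _ _ vF).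
  - move=> A B AB; apply: (@filterS _ _ uF) => s.
    by apply: (@filterS _ _ vF) => t; exact: AB.
split=> // F FP uvF; rewrite eqEsubset; split => // A FA.
have [//|uA] :=
  in_ultra_setVsetC [set s | ultra_sets v [set t | A (s * t)]] uU.
suff /uvF FnA : stone_mul_sets u v (~` A).
  exfalso; apply: (@filter_not_empty _ F).
  by rewrite -(setICr A); exact: filterI.
apply: (@filterS _ _ uF) uA => s.
by have [|] := in_ultra_setVsetC [set t | A (s * t)] vU.
Qed.

Definition stone_mul u v : stone_cech S := StoneCech (stone_mul_ultra u v).

Lemma stone_mulA : associative stone_mul.
Proof.
move=> u v w; apply: stone_cech_eq; apply/seteqP.
have E A : ultra_sets (stone_mul u (stone_mul v w)) A =
           ultra_sets (stone_mul (stone_mul u v) w) A.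
  rewrite /= /stone_mul_sets /=; congr ultra_sets; apply/funext => r /=.
  congr ultra_sets; apply/funext => s /=.
  by congr ultra_sets; apply/funext => t /=; rewrite mulgA.
by split=> A; rewrite E.
Qed.

HB.instance Definition _ := isSemigroup.Build (stone_cech S) stone_mulA.

End StoneCechSemigroup.

Definition schur (G : groupType) (u : stone_cech G) : Prop :=
  forall U : set G, ultra_sets u U -> exists x y, [/\ U x, U y & U (x * y)].

Definition congruence (S : semigroupType) (rho : set (S * S)) : Prop :=
  [/\ forall x, rho (x, x),
      forall x y, rho (x, y) -> rho (y, x),
      forall x y z, rho (x, y) -> rho (y, z) -> rho (x, z) &
      forall a1 b1 a2 b2,
        rho (a1, b1) -> rho (a2, b2) -> rho (a1 * a2, b1 * b2)].

Section QuotientSemigroup.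
Variables (S : preTopologicalSemigroupType) (rho : set (S * S)).
Variable rhoC : congruence rho.

Let rho_rel : rel S := fun x y => `[< rho (x, y) >].

Let rho_refl : reflexive rho_rel.
Proof. by case: rhoC => rxx _ _ _ x; exact/asboolP. Qed.

Let rho_sym : symmetric rho_rel.
Proof.
by case: rhoC => _ rs _ _ x y; apply/idP/idP => /asboolP /rs ?; exact/asboolP.
Qed.

Let rho_trans : transitive rho_rel.
Proof.
case: rhoC => _ _ rt _ y x z /asboolP xy /asboolP yz.
by apply/asboolP; exact: rt xy yz.
Qed.

Definition congruence_equiv : equiv_rel S :=
  EquivRel rho_rel rho_refl rho_sym rho_trans.

Definition congruence_quotient : Type :=
  quotient_topology {eq_quot congruence_equiv}.

HB.instance Definition _ := Quotient.on congruence_quotient.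
HB.instance Definition _ := Topological.on congruence_quotient.

Local Notation Q := congruence_quotient.

Definition congr_class (x : S) : Q := \pi_Q x.

Lemma congr_class_repr (a : Q) : congr_class (repr a) = a.
Proof. exact: reprK. Qed.

Lemma congr_classP (x y : S) : congr_class x = congr_class y <-> rho (x, y).
Proof. by apply: (rwP2 (eqmodP congruence_equiv x y)); exact: asboolP. Qed.

Lemma open_congr_class (U : set Q) : open U = open (congr_class @^-1` U).
Proof. by []. Qed.

(* The representatives are immaterial: see quotient_mulE. *)
Definition quotient_mul (a b : Q) : Q := congr_class (repr a * repr b).

Lemma quotient_mulE (x y : S) :
  quotient_mul (congr_class x) (congr_class y) = congr_class (x * y).
Proof.
case: rhoC => _ _ _ rm.
by apply/congr_classP/rm; apply/congr_classP; rewrite congr_class_repr.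
Qed.

Lemma quotient_mulA : associative quotient_mul.
Proof.
move=> a b c.
rewrite -[a]congr_class_repr -[b]congr_class_repr -[c]congr_class_repr.
by rewrite !quotient_mulE mulgA.
Qed.

HB.instance Definition _ := isSemigroup.Build Q quotient_mulA.

End QuotientSemigroup.

Section LeastClosedCongruence.
Variables (S : preTopologicalSemigroupType) (R : set (S * S)).

Definition closed_congruence (rho : set (S * S)) : Prop :=
  congruence rho /\ closed rho.

Definition least_closed_congruence : set (S * S) :=
  smallest closed_congruence R.

Lemma least_closed_congruenceP : closed_congruence least_closed_congruence.
Proof.
split; last by apply: closed_bigI => rho [[_ ?] _].
split.
- by move=> x rho [[[rr _ _ _] _] _]; exact: rr.
- move=> x y xy rho P; case: (P) => -[[_ rs _ _] _] _.
  by apply: rs; exact: xy.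
- move=> x y z xy yz rho P; case: (P) => -[[_ _ rt _] _] _.
  by apply: (rt _ y); [exact: xy|exact: yz].
- move=> a1 b1 a2 b2 ab1 ab2 rho P; case: (P) => -[[_ _ _ rm] _] _.
  by apply: rm; [exact: ab1|exact: ab2].
Qed.

Lemma sub_least_closed_congruence : R `<=` least_closed_congruence.
Proof. exact: sub_smallest. Qed.

Lemma least_closed_congruence_min (rho : set (S * S)) :
  closed_congruence rho -> R `<=` rho -> least_closed_congruence `<=` rho.
Proof. by move=> rhoC Rrho; exact: smallest_sub. Qed.

End LeastClosedCongruence.

Section BohrQuotient.
Variable G : groupType.

Definition Xi : set (stone_cech G * stone_cech G) :=
  least_closed_congruence
    [set (u, principal_ultra (1 : G)) | u in [set u | schur u]].

Lemma Xi_congruence : congruence Xi.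
Proof. by case: (least_closed_congruenceP
  [set (u, principal_ultra (1 : G)) | u in [set u | schur u]]). Qed.

Definition stone_cech_mod_Xi : preTopologicalSemigroupType :=
  congruence_quotient Xi_congruence.

Definition h_Xi (x : discrete_topology G) : stone_cech_mod_Xi :=
  congr_class Xi_congruence (principal_ultra (x : G)).

End BohrQuotient.

(* Main.v *)
Require Import Defs.
From HB Require Import structures.
From mathcomp Require Import all_boot generic_quotient all_classical topology.

(** Write K for the quotient of the compactification beta G by Xi.

    For an ultrafilter u let u^-1 be its image under inversion.  A set in
    u^-1 u contains s^-1 t, t^-1 r and s^-1 r for suitable s, t, r, and the
    last of these is the product of the other two; so u^-1 u is Schur, and
    u u^-1 likewise (schur_mulVu, schur_muluV).  Hence [u^-1] is an inverse
    of [u] in K, and K is a group with continuous inversion.  It is compact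
    as an image of beta G, and Hausdorff because Xi is closed
    (quotient_hausdorff).  Right translations of K are continuous because
    those of beta G are, and conjugating them by inversion makes the left
    translations continuous too.

    So K is a compact Hausdorff group with separately continuous
    multiplication and continuous inversion, and Ellis' theorem says that its
    multiplication is jointly continuous.  This is proved directly
    (cluster_mul_unit, ellis_joint_continuity).  Suppose that x y comes close
    to c for x and y arbitrarily close to 1, and let N be an open
    neighbourhood of c^-1.  Separate continuity is enough to choose pairs
    (x_1, y_1), (x_2, y_2), ... one after the other so that, with
    s_k = (x_1 y_1 c^-1) ... (x_{k-1} y_{k-1} c^-1) x_k, every s_i^-1 s_k with
    i < k is in N: such a product is
    y_i c^-1 (x_{i+1} y_{i+1}) c^-1 ... (x_{k-1} y_{k-1}) c^-1 x_k, and taking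
    limits one pair at a time turns it into c^-1 (c c^-1) ... (c c^-1).  A
    cluster point p of the sequence then gives p^-1 p = 1 in the closure
    of N.  As N was arbitrary, c = 1.

    For the universal property, a homomorphism f from G to a compact group H
    extends to beta G by taking limits along ultrafilters
    (stone_extension), and the extension is again a continuous homomorphism.
    If u is Schur and h is the limit of f along u, then points of the form
    f x f y = f (x y) are close both to h h and to h, so h is idempotent and
    therefore 1 (schur_limit_idempotent).  The kernel of the extension is thus
    a closed congruence containing the generators of Xi, and the extension
    factors through K. *)

Set Implicit Arguments.
Unset Strict Implicit.
Unset Printing Implicit Defensive.

Local Open Scope classical_set_scope.
Local Open Scope group_scope.

(** * Joint continuity from separate continuity in compact groups *)

Lemma near_all_seq (T : Type) (I : eqType) (F : set_system T) (l : seq I)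
    (P : I -> set T) : Filter F ->
  (forall s, s \in l -> F (P s)) -> F [set x | forall s, s \in l -> P s x].
Proof.
move=> FF; elim: l => [_|a l IH H]; first by apply: filterS filterT.
have Ha := H a (mem_head _ _).
have Hl : F [set x | forall s, s \in l -> P s x].
  by apply: IH => s sl; apply: H; rewrite inE sl orbT.
apply: filterS (filterI Ha Hl) => x [Pa Pl] s.
by rewrite inE => /orP[/eqP->//|]; exact: Pl.
Qed.

Section Ellis.
Context (K : preTopologicalSemigroupType) (e : K) (inv : K -> K).
Context (hK : hausdorff_space K) (cK : compact [set: K]).
Context (mule1 : left_id e *%g) (mul1e : right_id e *%g).
Context (mulVe : left_inverse e inv *%g) (muleV : right_inverse e inv *%g).
Context (mull : forall a : K, continuous (fun x => a * x)).
Context (mulr : forall b : K, continuous (fun x : K => x * b)).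
Context (cinv : continuous inv).

Local Notation mul := (fun xy : K * K => xy.1 * xy.2).

(** A state is a pair of the list of the points s_i chosen so far, latest
    first, and the product m = (x_1 y_1 c^-1) ... (x_k y_k c^-1), from which
    the next point is m x.  The construction is kept going by the invariant
    that s_i^-1 m is in N for every i: as x is near 1, it gives
    s_i^-1 (m x) in N. *)
Definition ladder_step (N : set K) (st st' : seq K * K) : Prop :=
  exists x, [/\ st'.1 = x :: st.1, forall s, s \in st.1 -> N (inv s * x) &
    forall s, s \in st'.1 -> N (inv s * st'.2)].

(** The finitely many conditions on x, on y and on x y hold near 1, 1 and c
    respectively by separate continuity, because
    s^-1 m (x y) c^-1 tends to s^-1 m (c c^-1) = s^-1 m; the clustering
    hypothesis yields x and y that satisfy all of them at once. *)
Lemma ladder_stepP (N : set K) (c : K) (st : seq K * K) :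
  cluster (mul @ (e, e)) c -> open N -> N (inv c) ->
  (forall s, s \in st.1 -> N (inv s * st.2)) ->
  exists st', ladder_step N st st'.
Proof.
case: st => l m clc oN Nc /= Nl.
have nN (f : K -> K) a : continuous f -> N (f a) -> nbhs a (f @^-1` N).
  by move=> cf Nfa; apply: cf; exact: open_nbhs_nbhs.
have nA : nbhs e [set x | forall s, s \in l -> N (inv s * m * x)].
  apply: near_all_seq => s sl; apply: (nN (fun x => inv s * m * x)) => //.
  by rewrite mul1e; exact: Nl.
have nC : nbhs c [set z | forall s, s \in l -> N (inv s * m * z * inv c)].
  apply: near_all_seq => s sl.
  apply: (nN (fun z => inv s * m * z * inv c)).
    move=> z; apply: (@continuous_comp _ _ _ (fun z => inv s * m * z)
      (fun z => z * inv c)); [exact: mull|exact: mulr].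
  by rewrite -mulgA muleV mul1e; exact: Nl.
have nB : nbhs e [set y | N (y * inv c)].
  by apply: (nN (fun y => y * inv c)) => //; rewrite mule1.
have nAB : (mul @ (e, e)) (mul @` ([set x | forall s, s \in l ->
    N (inv s * m * x)] `*` [set y | N (y * inv c)])).
  apply: (@filterS _ _ _ _ _ (@preimage_image _ _ mul _)).
  by exists ([set x | forall s, s \in l -> N (inv s * m * x)],
    [set y | N (y * inv c)]).
have [z [[[x y] [/= Ax By] <-] Cxy]] := clc _ _ nAB nC.
exists (m * x :: l, m * x * y * inv c), (m * x); split => //=.
  by move=> s /Ax; rewrite mulgA.
(* For the new point s = m x, the invariant reads y c^-1 in N. *)
move=> s; rewrite inE => /orP[/eqP->|/Cxy].
  by rewrite -(mulgA (m * x)) (mulgA (inv _)) mulVe mule1.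
by rewrite /= !mulgA.
Qed.

Lemma ladder (N : set K) (c : K) :
  cluster (mul @ (e, e)) c -> open N -> N (inv c) ->
  exists s : nat -> K, forall i k, (i < k)%N -> N (inv (s i) * s k).
Proof.
move=> clc oN Nc.
pose good (st : seq K * K) := forall s, s \in st.1 -> N (inv s * st.2).
have [f fP] : {f : seq K * K -> seq K * K & forall st, good st ->
    ladder_step N st (f st)}.
  apply: (@choice _ _ (fun st st' => good st -> ladder_step N st st')) => st.
  have [gst|ngst] := pselect (good st); last by exists st.
  by have [st' ?] := ladder_stepP clc oN Nc gst; exists st'.
pose st k := iter k f ([::], e).
have gst k : good (st k).
  by elim: k => [//|k IH]; have [x [_ _]] := fP _ IH.
pose s k := head e (st k.+1).1.
have stS k : (st k.+1).1 = s k :: (st k).1.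
  by have [x [E _ _]] := fP _ (gst k); rewrite /s /= E.
exists s => i k ik.
have [x [E Nx _]] := fP _ (gst k).
have -> : s k = x by rewrite /s /= E.
apply: Nx; elim: k ik {E} => // k IH.
by rewrite ltnS leq_eqVlt stS inE => /orP[/eqP->|/IH->]; rewrite ?eqxx ?orbT.
Qed.

(** In the ladder s_i^-1 s_k, letting k and then i tend to a cluster point p
    puts p^-1 p, which is the unit, in the closure of every neighbourhood of
    the inverse of c.  Each limit moves a single variable, so continuous
    translations and inversion suffice. *)
Lemma cluster_mul_unit (c : K) : cluster (mul @ (e, e)) c -> c = e.
Proof.
move=> clc; suff E : inv c = e by rewrite -(mule1 c) -E mulVe.
apply: hK => A V nA nV; pose N := A°.
have oN : open N by exact: open_interior.
have [s sN] := ladder clc oN nA.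
have [p [_ clp]] : [set: K] `&` cluster (s @ \oo) !=set0.
  by apply: cK => //; exact: filterT.
have closedN (f : K -> K) : continuous f -> closed (f @^-1` closure N).
  by move=> /continuous_closedP; apply; exact: closed_closure.
have sp i : closure N (inv (s i) * p).
  pose E := [set g | closure N (inv (s i) * g)].
  have cE : closed E by exact: closedN.
  apply: cE; move: clp; rewrite clusterE; apply.
  apply: (@filterS _ \oo _ _ (s @^-1` E) _ (nbhs_infty_gt i)) => k ik.
  exact: (@subset_closure _ N _ (sN _ _ ik)).
suff : closure N e.
  move=> /(_ V nV) [x [Nx Vx]]; exists x; split => //.
  exact: interior_subset Nx.
rewrite -(mulVe p).
have cD : closed [set g | closure N (inv g * p)].
  apply: (closedN (fun g => inv g * p)) => g.
  apply: (@continuous_comp _ _ _ inv (fun x => x * p)); first exact: cinv.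
  exact: mulr.
apply: cD; move: clp; rewrite clusterE; apply.
by apply: (@filterE _ \oo) => k; exact: sp.
Qed.

(** By compactness it is enough that a b is the only cluster point of x y as
    (x, y) tends to (a, b).  Replacing x by a^-1 x and y by y b^-1 moves the
    base point to the unit and a cluster point w to a^-1 w b^-1. *)
Lemma ellis_joint_continuity : continuous mul.
Proof.
case=> a b; apply: (@compact_cluster_set1 _ _ _ setT) => //=.
- exact: filterT.
- exact: filterT.
have clE : cluster (mul @ (a, b)) `<=` [set a * b].
  move=> w clw /=.
  suff /cluster_mul_unit E : cluster (mul @ (e, e)) (inv a * w * inv b).
    have {1}-> : w = a * (inv a * w * inv b) * b.
      by rewrite -!mulgA mulVe mul1e mulgA muleV mule1.
    by rewrite E mul1e.
  move=> P C nP nC.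
  have ct : continuous (fun z => inv a * z * inv b).
    move=> z; apply: (@continuous_comp _ _ _ (fun z => inv a * z)
      (fun z => z * inv b)); [exact: mull|exact: mulr].
  have nP' : (mul @ (a, b)) [set z | P (inv a * z * inv b)].
    suff H : (fun xy : K * K => (inv a * xy.1, xy.2 * inv b)) @ (a, b) -->
        (e, e).
      apply: (@filterS _ (nbhs (a, b)) _ _ _ _ (H _ nP)) => -[x y] /=.
      by rewrite /= !mulgA.
    have cl : continuous (fun xy : K * K => inv a * xy.1).
      by move=> xy; apply: continuous_comp; [exact: cvg_fst|exact: mull].
    have cr : continuous (fun xy : K * K => xy.2 * inv b).
      by move=> xy; apply: (@continuous_comp _ _ _ snd (fun y => y * inv b));
        [exact: cvg_snd|exact: mulr].
    apply: cvg_pair => /=.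
      by rewrite -(mulVe a); exact: (cl (a, b)).
    by rewrite -(muleV b); exact: (cr (a, b)).
  have [z [Pz Cz]] := clw _ _ nP' (ct w _ nC).
  by exists (inv a * z * inv b).
apply/seteqP; split => // _ ->.
have [w [_ clw]] : [set: K] `&` cluster (mul @ (a, b)) !=set0.
  by apply: cK => //; exact: filterT.
by have E : w = a * b := clE _ clw; rewrite E in clw.
Qed.
End Ellis.

(** * Quotients of compact semigroups by closed congruences *)

Section CompactQuotient.
Context (S : preTopologicalSemigroupType) (rho : set (S * S)).
Context (rhoC : congruence rho).
Local Notation Q := (congruence_quotient rhoC).
Local Notation cl := (congr_class rhoC).

Lemma congr_class_continuous : continuous cl.
Proof. exact: pi_continuous. Qed.

Lemma continuous_classP (Z : topologicalType) (f : Q -> Z) :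
  continuous f <-> continuous (f \o cl).
Proof. exact: quotient_continuous. Qed.

Lemma congr_class_surj (q : Q) : exists x, cl x = q.
Proof. by exists (repr q); exact: congr_class_repr. Qed.

Lemma congr_classM (x y : S) : cl x * cl y = cl (x * y).
Proof. exact: quotient_mulE. Qed.

Lemma quotient_compact : compact [set: S] -> compact [set: Q].
Proof.
move=> cS.
have -> : [set: Q] = cl @` setT.
  by apply/seteqP; split=> // q _; have [x <-] := congr_class_surj q; exists x.
apply: continuous_compact => //.
exact/continuous_subspaceT/congr_class_continuous.
Qed.

Context (hS : hausdorff_space S) (cS : compact [set: S]).
Context (rho_closed : closed rho).

Let sat (A : set S) := [set y | exists2 x, A x & rho (x, y)].

(** The saturation of A is the projection of a closed, hence compact, part of
    the relation. *)
Lemma sat_closed A : closed A -> closed (sat A).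
Proof.
move=> cA; apply: compact_closed => //.
have -> : sat A = snd @` (rho `&` (A `*` setT)).
  apply/seteqP; split=> [y [x Ax xy]|_ [[x y] [/= xy [Ax _]] <-]].
    by exists (x, y).
  by exists x.
have c1 : continuous (@fst S S) by move=> ?; exact: cvg_fst.
have c2 : continuous (@snd S S) by move=> ?; exact: cvg_snd.
apply: continuous_compact; first exact: continuous_subspaceT.
apply: (@subclosed_compact _ _ (setT `*` setT)); last by [].
  apply: closedI => //.
  have -> : A `*` [set: S] = fst @^-1` A by apply/seteqP; split=> -[x y] // [].
  by move/continuous_closedP: c1; apply.
exact: compact_setX.
Qed.

(** Two distinct classes are disjoint closed sets of a normal space, so they
    have disjoint open neighbourhoods; the classes contained in such a
    neighbourhood form an open set of the quotient, since the complement of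
    their union is the saturation of a closed set. *)
Lemma quotient_hausdorff : hausdorff_space Q.
Proof.
move=> a b clab; apply: contrapT => ab.
have satE q : sat [set repr q] = cl @^-1` [set q].
  apply/seteqP; split=> [y [_ -> /(congr_classP rhoC) E]|y /= yq].
    by rewrite /= -E congr_class_repr.
  by exists (repr q) => //; apply/(congr_classP rhoC); rewrite congr_class_repr.
have clq q : closed (cl @^-1` [set q]).
  rewrite -satE; apply: sat_closed; apply: compact_closed => //.
  exact: compact_set1.
have open_core (U : set S) : open U -> open [set q | cl @^-1` [set q] `<=` U].
  move=> oU; rewrite open_congr_class.
  have -> : cl @^-1` [set q | cl @^-1` [set q] `<=` U] = ~` sat (~` U).
    apply/seteqP; split => [y /= yU [x nUx xy]|y /= nsy x xy].
      by apply: nUx; apply: yU; exact/(congr_classP rhoC).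
    apply: contrapT => nUx; apply: nsy; exists x => //.
    exact/(congr_classP rhoC).
  by apply/closed_openC/sat_closed/open_closedC.
have [P nP PB] : exists2 P, set_nbhs (cl @^-1` [set a]) P &
    closure P `<=` ~` (cl @^-1` [set b]).
  apply: (compact_normal hS cS (clq a)); apply/set_nbhsP.
  exists (~` (cl @^-1` [set b])); split => //; first exact: closed_openC.
  by move=> x /= -> /ab.
have /set_nbhsP[C [oC aC CP]] := nP.
have na : nbhs a [set q | cl @^-1` [set q] `<=` C].
  by apply: open_nbhs_nbhs; split => //; exact: open_core.
have nb : nbhs b [set q | cl @^-1` [set q] `<=` ~` closure P].
  apply: open_nbhs_nbhs; split.
    exact/open_core/closed_openC/closed_closure.
  by move=> x xb Px; exact: PB xb.
have [q [/= qC qP]] := clab _ _ na nb.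
have [x xq] := congr_class_surj q.
by apply: (qP x xq); apply/subset_closure/CP/qC.
Qed.

Lemma quotient_mulr_continuous :
  (forall v : S, continuous (fun u : S => u * v)) ->
  forall q : Q, continuous (fun p : Q => p * q).
Proof.
move=> cr q; have [v <-] := congr_class_surj q.
apply/continuous_classP.
have -> : (fun p : Q => p * cl v) \o cl = cl \o (fun u => u * v).
  by apply/funext => x /=; exact: congr_classM.
by move=> u; apply: continuous_comp; [exact: cr|exact: congr_class_continuous].
Qed.
End CompactQuotient.

(** * The space of ultrafilters *)

Lemma fmap_ultra (S T : Type) (f : S -> T) (F : set_system S) :
  UltraFilter F -> UltraFilter (f @ F).
Proof.
move=> FU; split=> [|H HP FH]; first exact: fmap_proper_filter.
rewrite eqEsubset; split => // A HA.
have [//|FnA] := in_ultra_setVsetC (f @^-1` A) FU.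
have HnA : H (~` A) by exact: FH.
exfalso; apply: (@filter_not_empty _ H).
by rewrite -(setICr A); exact: filterI.
Qed.

Section StoneCechSpace.
Context (S : Type).
Implicit Types u v : stone_cech S.

Lemma open_stone_base (A : set S) : open (stone_base A).
Proof. by exists [set A] => //; rewrite bigcup_set1. Qed.

Lemma stone_nbhsP u (P : set (stone_cech S)) :
  nbhs u P <-> exists2 A, ultra_sets u A & stone_base A `<=` P.
Proof.
split=> [|[A uA AP]].
  rewrite nbhsE => -[O [[D _ <-] [A DA uA]] OP].
  by exists A => // v vA; apply: OP; exists A.
apply: (@filterS _ (nbhs u) _ _ _ AP); apply: open_nbhs_nbhs.
by split => //; exact: open_stone_base.
Qed.

Lemma stone_continuous (T : topologicalType) (f : T -> stone_cech S) :
  (forall A, open (f @^-1` stone_base A)) -> continuous f.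
Proof.
move=> fo x P /stone_nbhsP[A fxA AP].
apply: (@filterS _ (nbhs x) _ (f @^-1` stone_base A)); first by move=> y /AP.
exact: open_nbhs_nbhs.
Qed.

Lemma stone_hausdorff : hausdorff_space (stone_cech S).
Proof.
move=> u v uv; apply: stone_cech_eq; have uU := ultra_setsP u.
have vU := ultra_setsP v.
suff vu : ultra_sets v `<=` ultra_sets u by exact: (@max_filter _ _ vU).
move=> A vA; have [//|unA] := in_ultra_setVsetC A uU.
have nu : nbhs u (stone_base (~` A)) by apply/stone_nbhsP; exists (~` A).
have nv : nbhs v (stone_base A) by apply/stone_nbhsP; exists A.
have [w [/= wnA wA]] := uv _ _ nu nv; have wU := ultra_setsP w.
exfalso; apply: (@filter_not_empty _ (ultra_sets w)).
by rewrite -(setICr A); exact: filterI.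
Qed.

(** An ultrafilter F of points converges to the ultrafilter of the sets A for
    which F contains the basic open set given by A. *)
Lemma stone_compact : compact [set: stone_cech S].
Proof.
rewrite compact_ultra => F FU _.
pose uS := [set A | F (stone_base A)].
have baseC A : ~` stone_base A = stone_base (~` A).
  apply/seteqP; split=> w /=; have wU := ultra_setsP w.
    by rewrite /stone_base /=; have [|] := in_ultra_setVsetC A wU.
  move=> wnA wA; apply: (@filter_not_empty _ (ultra_sets w)).
  by rewrite -(setICr A); exact: filterI.
have FP : ProperFilter F by exact: ultra_proper.
have uP : ProperFilter uS.
  split.
    move=> F0; apply: (@filter_not_empty _ F).
    apply: (@filterS _ F _ (stone_base set0) _ _ F0) => w /=.
    have wU := ultra_setsP w.
    exact: filter_not_empty.
  split.
  - apply: (@filterE _ F) => w; have wU := ultra_setsP w.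
    exact: (@filterT _ (ultra_sets w)).
  - move=> A B FA FB.
    apply: (@filterS _ F _ _ _ _ (@filterI _ F _ _ _ FA FB)) => w [wA wB].
    by have wU := ultra_setsP w; exact: (@filterI _ (ultra_sets w)).
  - move=> A B AB; apply: (@filterS _ F) => w.
    by have wU := ultra_setsP w; exact: (@filterS _ (ultra_sets w)).
have uU : UltraFilter uS.
  split=> // H HP uH; rewrite eqEsubset; split => // A HA.
  have [//|] := in_ultra_setVsetC (stone_base A) FU.
  rewrite baseC => /uH HnA; exfalso; apply: (@filter_not_empty _ H).
  by rewrite -(setICr A); exact: filterI.
exists (StoneCech uU); split => // P /stone_nbhsP[A uA AP].
exact: filterS AP uA.
Qed.

Lemma principal_dense : dense (range (@principal_ultra S)).
Proof.
move=> O [u Ou] oO.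
have /stone_nbhsP[A uA AO] : nbhs u O by exact: open_nbhs_nbhs.
have uU := ultra_setsP u.
have [x Ax] := @filter_ex _ (ultra_sets u) _ _ uA.
exists (principal_ultra x); split; last by exists x.
by apply: AO; exact/principal_filterP.
Qed.
End StoneCechSpace.

Section StoneCechShift.
Context (S : semigroupType).
Implicit Types u v : stone_cech S.

Lemma stone_mulr_continuous v : continuous (fun u => u * v).
Proof. by apply: stone_continuous => A; exact: open_stone_base. Qed.

Lemma principal_ultraM (x y : S) :
  principal_ultra (x * y) = principal_ultra x * principal_ultra y.
Proof.
apply: stone_cech_eq; apply/funext => A.
apply/propext; split=> [/principal_filterP Axy|/principal_filterP].
  by apply/principal_filterP/principal_filterP.
by move=> /principal_filterP Axy; exact/principal_filterP.
Qed.
End StoneCechShift.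

(** * Extension to the Stone-Cech compactification by limits *)

Section Extension.
Context (H : preTopologicalSemigroupType).
Context (hH : hausdorff_space H) (cH : compact [set: H]).

Lemma stone_extension (S : Type) (f : S -> H) :
  exists fh : stone_cech S -> H, forall u, f @ ultra_sets u --> fh u.
Proof.
suff : forall u, exists h : H, f @ ultra_sets u --> h.
  by move=> hP; have [fh fhP] := choice hP; exists fh.
move=> u; have uU := ultra_setsP u; have fuU := fmap_ultra f uU.
have := cH; rewrite compact_ultra => /(_ _ fuU filterT)[h [_ ?]].
by exists h.
Qed.

(** Regularity of the target provides a closed neighbourhood N of the limit at
    u; the limit along any ultrafilter containing the preimage of N stays
    in N. *)
Lemma stone_extension_continuous (S : Type) (f : S -> H)
    (fh : stone_cech S -> H) :
  (forall u, f @ ultra_sets u --> fh u) -> continuous fh.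
Proof.
move=> fhP u O nO.
have [N nN NO] : exists2 N, nbhs (fh u) N & closure N `<=` O.
  have nT : nbhs (fh u) setT by exact: filterT.
  have R := compact_regular hH cH nT.
  exact: (R O nO).
apply/stone_nbhsP; exists (f @^-1` N); first exact: fhP nN.
move=> v vN; apply: NO; have vU := ultra_setsP v.
apply: (@closed_cvg _ _ (ultra_sets v) _ f (closure N)) (fhP v).
  exact: closed_closure.
by apply: (@filterS _ (ultra_sets v)) vN => x; exact: subset_closure.
Qed.

Lemma stone_extension_principal (S : Type) (f : S -> H)
    (fh : stone_cech S -> H) :
  (forall u, f @ ultra_sets u --> fh u) ->
  forall x, fh (principal_ultra x) = f x.
Proof.
move=> fhP x; have xU := ultra_setsP (principal_ultra x).
apply: (@cvg_unique _ hH (f @ ultra_sets (principal_ultra x))).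
  exact: fhP.
by move=> P /nbhs_singleton Pfx; exact/principal_filterP.
Qed.

Context (mulc : continuous (fun xy : H * H => xy.1 * xy.2)).

Lemma nbhs_mul (a b : H) (P : set H) : nbhs (a * b) P ->
  exists A B, [/\ nbhs a A, nbhs b B & forall x y, A x -> B y -> P (x * y)].
Proof.
move=> nP; have [[A B] [/= nA nB] ABP] := @mulc (a, b) _ nP.
by exists A, B; split => // x y Ax By; exact: (ABP (x, y)).
Qed.

(** The product of ultrafilters is an iterated limit: f (s t) = f s f t tends
    to f s times the limit along v, and then to the product of both
    limits. *)
Lemma stone_extensionM (S : semigroupType) (f : S -> H)
    (fh : stone_cech S -> H) :
  (forall u, f @ ultra_sets u --> fh u) -> {morph f : x y / x * y} ->
  {morph fh : u v / u * v}.
Proof.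
move=> fhP fM u v; have uvU := ultra_setsP (u * v).
have uU := ultra_setsP u; have vU := ultra_setsP v.
apply: (@cvg_unique _ hH (f @ ultra_sets (u * v))); first exact: fhP.
move=> P; rewrite nbhsE => -[O [oO Ouv] OP].
have nO : nbhs (fh u * fh v) O by exact: open_nbhs_nbhs.
have [A [B [nA nB ABO]]] := nbhs_mul nO.
apply: (@filterS _ (ultra_sets u)) (fhP u _ nA) => s Afs /=.
have {}nO : nbhs (f s * fh v) O.
  apply: open_nbhs_nbhs; split => //; apply: ABO => //.
  exact: nbhs_singleton.
have [A' [B' [nA' nB' AB'O]]] := nbhs_mul nO.
apply: (@filterS _ (ultra_sets v)) (fhP v _ nB') => t Bft /=.
by rewrite fM; apply/OP/AB'O => //; exact: nbhs_singleton.
Qed.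

(** In any neighbourhood of the limit there are f x, f y and their product
    f (x y), so joint continuity forces h h and h to have no disjoint
    neighbourhoods. *)
Lemma schur_limit_idempotent (G : groupType) (f : G -> H) (u : stone_cech G) h :
  {morph f : x y / x * y} -> schur u -> f @ ultra_sets u --> h -> h * h = h.
Proof.
move=> fM su uh; apply: hH => P Q nP nQ; have uU := ultra_setsP u.
have [A [B [nA nB ABP]]] := nbhs_mul nP.
have [x [y [[[Ax _] _] [[_ By] _] [_ Qxy]]]] :=
  su _ (uh _ (filterI (filterI nA nB) nQ)).
by exists (f (x * y)); split => //; rewrite fM; exact: ABP.
Qed.
End Extension.

(** * Inverses of ultrafilters *)

Section Inverse.
Context (G : groupType).
Implicit Types u v : stone_cech G.

Definition stone_inv u : stone_cech G :=
  StoneCech (fmap_ultra (fun x : G => x^-1) (ultra_setsP u)).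

Lemma stone_inv_continuous : continuous stone_inv.
Proof. by apply: stone_continuous => A; exact: open_stone_base. Qed.

(** Elements s, t, r chosen successively for u give the triple s^-1 t, t^-1 r
    and s^-1 r in A, the last being the product of the other two. *)
Lemma schur_mulVu u : schur (stone_inv u * u).
Proof.
move=> A uA; have uU := ultra_setsP u.
pose D s := [set t : G | A (s^-1 * t)].
have {}uA : ultra_sets u [set s | ultra_sets u (D s)] by exact: uA.
have [s us] := @filter_ex _ (ultra_sets u) _ _ uA.
have [t [Dst ut]] := @filter_ex _ (ultra_sets u) _ _ (filterI us uA).
have [r [Dsr Dtr]] := @filter_ex _ (ultra_sets u) _ _ (filterI us ut).
exists (s^-1 * t), (t^-1 * r); split => //.
by rewrite -mulgA (mulgA t) mulgV mul1g.
Qed.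

(** Here the triple is s t^-1, t r^-1 and s r^-1. *)
Lemma schur_muluV u : schur (u * stone_inv u).
Proof.
move=> A uA; have uU := ultra_setsP u.
pose D s := [set t : G | A (s * t^-1)].
have {}uA : ultra_sets u [set s | ultra_sets u (D s)] by exact: uA.
have [s us] := @filter_ex _ (ultra_sets u) _ _ uA.
have [t [Dst ut]] := @filter_ex _ (ultra_sets u) _ _ (filterI us uA).
have [r [Dsr Dtr]] := @filter_ex _ (ultra_sets u) _ _ (filterI us ut).
exists (s * t^-1), (t * r^-1); split => //.
by rewrite -mulgA (mulgA t^-1) mulVg mul1g.
Qed.

Lemma stone_mul1u u : principal_ultra (1 : G) * u = u.
Proof.
apply: stone_cech_eq; apply/funext => A.
have E : [set t | A (1 * t)] = A by apply/funext => t; rewrite /= mul1g.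
apply/propext; split=> [/principal_filterP|uA].
  by rewrite /= E.
by apply/principal_filterP; rewrite /= E.
Qed.

Lemma stone_mulu1 u : u * principal_ultra (1 : G) = u.
Proof.
apply: stone_cech_eq; apply/funext => A /=.
rewrite /stone_mul_sets /=; congr ultra_sets; apply/funext => s.
apply/propext; split=> [/principal_filterP|As]; first by rewrite /= mulg1.
by apply/principal_filterP; rewrite /= mulg1.
Qed.
End Inverse.

(** * The quotient by the congruence of Schur ultrafilters *)

Section BohrGroup.
Context (G : groupType).
Local Notation K := (stone_cech_mod_Xi G).
Local Notation cl := (congr_class (Xi_congruence G)).
Implicit Types u v : stone_cech G.

Local Notation e := (cl (principal_ultra (1 : G))).

Definition bohr_inv (q : K) : K := cl (stone_inv (repr q)).
Local Notation inv := bohr_inv.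

Lemma schur_class u : schur u -> cl u = e.
Proof.
move=> su; apply/congr_classP; apply: sub_least_closed_congruence.
by exists u.
Qed.

Lemma Xi_closed : closed (@Xi G).
Proof. by have [] := least_closed_congruenceP
  [set (u, principal_ultra (1 : G)) | u in [set u | schur u]]. Qed.

Lemma bohr_hausdorff : hausdorff_space K.
Proof.
exact: (quotient_hausdorff (@stone_hausdorff G) (@stone_compact G) Xi_closed).
Qed.

Lemma bohr_compact : compact [set: K].
Proof. by apply: quotient_compact; exact: stone_compact. Qed.

Lemma bohr_mule1 : left_id e *%g.
Proof.
move=> q; have [u <-] := congr_class_surj q; rewrite congr_classM.
by rewrite stone_mul1u.
Qed.

Lemma bohr_mul1e : right_id e *%g.
Proof.
move=> q; have [u <-] := congr_class_surj q; rewrite congr_classM.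
by rewrite stone_mulu1.
Qed.

Lemma bohr_mulVe : left_inverse e inv *%g.
Proof.
move=> q; rewrite -{2}(congr_class_repr q) congr_classM.
exact/schur_class/schur_mulVu.
Qed.

Lemma bohr_muleV : right_inverse e inv *%g.
Proof.
move=> q; rewrite -{1}(congr_class_repr q) congr_classM.
exact/schur_class/schur_muluV.
Qed.

Lemma bohr_inv_class u : inv (cl u) = cl (stone_inv u).
Proof.
rewrite -[LHS]bohr_mul1e -(schur_class (@schur_muluV G u)) -congr_classM.
by rewrite mulgA bohr_mulVe bohr_mule1.
Qed.

Lemma bohr_inv_continuous : continuous inv.
Proof.
apply/continuous_classP.
have -> : inv \o cl = cl \o @stone_inv G.
  by apply/funext => u; exact: bohr_inv_class.
move=> u; apply: continuous_comp; first exact: stone_inv_continuous.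
exact: congr_class_continuous.
Qed.

Lemma bohr_mulr_continuous (b : K) : continuous (fun a : K => a * b).
Proof.
by apply: quotient_mulr_continuous => v; exact: stone_mulr_continuous.
Qed.

(** Left translation by a is right translation by a^-1 conjugated by
    inversion, since a b = (b^-1 a^-1)^-1. *)
Lemma bohr_mull_continuous (a : K) : continuous (fun b : K => a * b).
Proof.
have invK : involutive inv.
  move=> b; rewrite -[LHS]bohr_mul1e -(bohr_mulVe b) mulgA.
  by rewrite bohr_mulVe bohr_mule1.
have -> : (fun b : K => a * b) = inv \o (fun b => b * inv a) \o inv.
  apply/funext => b /=; rewrite -[LHS]bohr_mule1.
  rewrite -(bohr_mulVe (inv b * inv a)) -mulgA -(mulgA (inv b)) (mulgA (inv a)).
  by rewrite bohr_mulVe bohr_mule1 bohr_mulVe bohr_mul1e.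
move=> b; apply: continuous_comp; first exact: bohr_inv_continuous.
apply: (@continuous_comp _ _ _ (fun b => b * inv a) inv).
  exact: bohr_mulr_continuous.
exact: bohr_inv_continuous.
Qed.

Lemma bohr_topological_group : compact_topological_group K.
Proof.
split; last exact: bohr_compact.
split; first exact: bohr_hausdorff.
exists e, inv; split.
- by split; [exact: bohr_mule1|exact: bohr_mul1e].
- by split; [exact: bohr_mulVe|exact: bohr_muleV].
- apply: (ellis_joint_continuity (e := e) (inv := inv)).
  + exact: bohr_hausdorff.
  + exact: bohr_compact.
  + exact: bohr_mule1.
  + exact: bohr_mul1e.
  + exact: bohr_mulVe.
  + exact: bohr_muleV.
  + exact: bohr_mull_continuous.
  + exact: bohr_mulr_continuous.
  + exact: bohr_inv_continuous.
- exact: bohr_inv_continuous.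
Qed.

Lemma bohr_dense : dense (range (@h_Xi G)).
Proof.
move=> O [q Oq] oO; have [u uq] := congr_class_surj q.
have [] := @principal_dense G (cl @^-1` O).
- by exists u; rewrite /= uq.
- have /continuousP := @congr_class_continuous _ _ (Xi_congruence G).
  by apply.
move=> v [Ov [x _ xv]]; rewrite -xv in Ov.
by exists (h_Xi x); split => //; exists x.
Qed.

(** The relation of having the same image under the extension of f is a closed
    congruence identifying Schur ultrafilters with the unit, so it contains
    Xi. *)
Lemma bohr_universal (H : preTopologicalSemigroupType)
    (f : discrete_topology G -> H) :
  compact_topological_group H -> continuous_hom f ->
  exists2 g : K -> H, continuous_hom g & f = g \o @h_Xi G.
Proof.
move=> [[hH [eH [invH [[eHx xeH] [Vx xV] mulc _]]]] cH] [_ fM].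
have [fh fhP] := stone_extension cH (f : G -> H).
have fhM : {morph fh : u v / u * v} by exact: (stone_extensionM hH mulc fhP fM).
have idem h : h * h = h -> h = eH.
  by move=> hh; rewrite -[LHS]eHx -(Vx h) -mulgA hh.
have fhc : continuous fh by exact: (stone_extension_continuous hH cH fhP).
pose ker := [set uv : stone_cech G * stone_cech G | fh uv.1 = fh uv.2].
have kerP : closed_congruence ker.
  split.
    split=> [//|u v /esym //|u v w /= uv|u1 v1 u2 v2 /= E1 E2].
      by rewrite /ker /= -uv.
    by rewrite /ker /= !fhM E1 E2.
  move=> [u v] cuv; apply: hH => P Q nP nQ.
  have [[u' v'] [/= E [Pu' Qv']]] :
      ker `&` ((fh @^-1` P) `*` (fh @^-1` Q)) !=set0.
    by apply: cuv; exists (fh @^-1` P, fh @^-1` Q) => //; split; exact: fhc.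
  by exists (fh u'); split => //; rewrite E.
have sub_ker : [set (u, principal_ultra (1 : G)) | u in [set u | schur u]]
    `<=` ker.
  move=> _ [u su <-] /=; rewrite /ker /=.
  rewrite (idem _ (schur_limit_idempotent hH mulc fM su (fhP u))).
  by apply/esym/idem; rewrite -fhM -principal_ultraM mulg1.
have fh_class u v : cl u = cl v -> fh u = fh v.
  by move=> /congr_classP; exact: (least_closed_congruence_min kerP sub_ker).
have reprE u : fh (repr (cl u)) = fh u.
  by apply: fh_class; rewrite congr_class_repr.
exists (fh \o repr).
  split.
    apply/continuous_classP.
    by have -> : fh \o repr \o cl = fh by apply/funext => u; exact: reprE.
  move=> p q; have [u <-] := congr_class_surj p.
  have [v <-] := congr_class_surj q.
  by rewrite congr_classM /= !reprE fhM.
apply/funext => x /=; rewrite reprE.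
by rewrite (stone_extension_principal hH fhP).
Qed.

Lemma discrete_topological_group : topological_group (discrete_topology G).
Proof.
split; first exact: discrete_hausdorff.
exists (1 : G), (fun x : G => x^-1); split.
- by split; [exact: mul1g|exact: mulg1].
- by split; [exact: mulVg|exact: mulgV].
- move=> [x y] P /nbhs_singleton Pxy.
  exists ([set x], [set y]); first by split; exact: discrete_set1.
  by move=> _ [/= -> ->].
- by apply/continuousP => A _; exact: discrete_open.
Qed.
End BohrGroup.

Theorem theorem2p7 (G : groupType) :
  bohr_compactification (@h_Xi G).
Proof.
split.
- exact: discrete_topological_group.
- exact: bohr_topological_group.
- split; last by move=> x y; rewrite /h_Xi congr_classM -principal_ultraM.
  by apply/continuousP => A _; exact: discrete_open.
- exact: bohr_dense.
- exact: bohr_universal.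
Qed.
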